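(* For odd $r$, as $r\to\infty$, $$s(r+1,r)\ge\frac1r+\frac{1-o(1)}{4r^6(r!)^2};$$ that is, there exist real numbers $\varepsilon_r$, for odd integers $r\ge3$, with $\varepsilon_r\to0$ as $r\to\infty$ over odd integers, such that for every odd integer $r\ge3$, $s(r+1,r)\ge\frac1r+\frac{1-\varepsilon_r}{4r^6(r!)^2}$.
   Context: Let $r<k$ be positive integers and $X$ a set. A sequence $x\in X^r$ covers a sequence $a\in X^k$ if $x$ is a (not necessarily contiguous) subsequence of $a$, i.e., $x$ is obtained from $a$ by removing $k-r$ entries while keeping the order of the remaining entries. A set $C\subseteq X^r$ covering $X^k$ (i.e., such that every sequence in $X^k$ is covered by at least one sequence in $C$) is called a covering $(k-r)$-insertion code over $X$. Write $[n]=\{0,1,\ldots,n-1\}$. $S(n,k,r)$ denotes the minimum cardinality of a covering $(k-r)$-insertion code $C\subseteq[n]^r$ over $[n]$, and $s(k,r)=\lim_{n\to\infty}S(n,k,r)/n^r$ (this limit exists). *)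

(* Defs.v *)
From HB Require Import structures.
From mathcomp Require Import all_boot all_order all_algebra.
From mathcomp Require Import all_classical all_reals all_analysis.

Set Implicit Arguments.
Unset Strict Implicit.
Unset Printing Implicit Defensive.

Import Order.TTheory GRing.Theory Num.Theory.
Import numFieldNormedType.Exports.

(* [subseq] allows non-contiguous subsequences.  For r < k this says that C is
   a covering (k - r)-insertion code over the alphabet X. *)
Definition covering_code (X : finType) (k r : nat) (C : {set r.-tuple X}) :
    bool :=
  [forall a : k.-tuple X, exists x in C, subseq x a].

(* S(n, k, r).  The full set [set: r.-tuple _] is the seed of the minimum; it is covering
   as soon as r <= k (see [covering_code_setT]). *)
Definition min_cover (n k r : nat) : nat :=
  #|[arg min_(C < [set: r.-tuple 'I_n] | covering_code k C) #|C|]|.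

Lemma covering_code_setT (X : finType) (k r : nat) :
  (r <= k)%N -> covering_code k [set: r.-tuple X].
Proof.
move=> rk; apply/forallP => a; apply/existsP.
have sz : size (take r a) == r by rewrite size_takel // size_tuple.
by exists (Tuple sz); rewrite inE take_subseq.
Qed.

Lemma min_coverP (n k r : nat) : (r <= k)%N ->
  (exists2 C : {set r.-tuple 'I_n}, covering_code k C & #|C| = min_cover n k r) /\
  (forall C : {set r.-tuple 'I_n}, covering_code k C -> (min_cover n k r <= #|C|)%N).
Proof.
move=> rk; rewrite /min_cover.
by case: arg_minnP => [|C covC minC]; [exact: covering_code_setT|split; [exists C|]].
Qed.

Local Open Scope ring_scope.
Local Open Scope classical_set_scope.

(* [limn] returns an arbitrary point on divergent sequences, so any bound on
   [cover_density] requires proving that the limit exists. *)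
Definition cover_density (R : realType) (k r : nat) : R :=
  limn (fun n : nat => (min_cover n k r)%:R / n%:R ^+ r : R).

(* Main.v *)
Require Import Defs.
From HB Require Import structures.
From mathcomp Require Import all_boot all_order all_algebra.
From mathcomp Require Import all_classical all_reals all_analysis.
From mathcomp Require Import ring lra zify.
Import Order.TTheory GRing.Theory Num.Theory.
Import numFieldNormedType.Exports.
Local Open Scope ring_scope.

(** Let [C] be a covering code in X^r, let [n] be the size of [X], and let
    [d = #|C| / n ^ r] be the density of [C]. For a sequence [a] of length
    [r + 1], let [g a] be the number of positions of [a] whose deletion gives an
    element of [C]; the covering property says [1 <= g a].

    De Caen's argument for Turan numbers carries over to sequences. Write
    [p_i b] for the number of letters whose insertion at position [i] of a
    sequence [b] of length [r - 1] gives a codeword. The number of ordered pairs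
    of distinct positions of [a] counted by [g a], summed over all [a], equals
    the sum over [b] of [(\sum_i p_i b) ^ 2 + \sum_i (p_i b) ^ 2]
    ([sum_hits_sqr]), and the Cauchy-Schwarz inequality bounds it from below.
    The result ([hits_deficit]) is that the average of [(g - 1) (r + 1 - g)] is
    at most [(r + 1) (1 - d) (r d - 1)]. Hence [d >= 1 / r], and if [d] is close
    to [1 / r], then [g] takes only the values [1] and [r + 1] on most
    sequences.

    For odd [r] this is impossible. Take a sequence [z] of length [r + 2] and the
    graph on its positions in which [i] and [j] are adjacent if deleting both
    from [z] gives a codeword. The degree of [v] is the value of [g] at [z]
    without its letter at [v]. If all degrees were [1] the graph would be a
    perfect matching on the odd number [r + 2] of vertices. If some degree is
    [r + 1], the degrees sum to at least [2 (r + 1)], because all others are at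
    least [1]; this amounts to a density of [2 / (r + 2)], which exceeds [1 / r].
    The remaining graphs are paid for by [(g - 1) (r + 1 - g)]. Averaging
    ([hits_local], [covering_density]) gives

      [2 <= (r + 2) (d + 2 (1 - d) (r d - 1))],

    so [d >= 1 / r + 1 / (4 r ^ 3)] for odd [r >= 3] and every nonempty alphabet
    ([density_bound]). This is stronger than the claim, already with a vanishing
    error term.

    The limit defining the density exists because pulling a code over [m]
    letters back along reduction modulo [m] gives a covering code over [N]
    letters whose density is at most [(1 + m / N) ^ r] times that of the original
    code ([density_blowup]). *)

Set Implicit Arguments.
Unset Strict Implicit.
Unset Printing Implicit Defensive.

(** * Deleting and inserting letters *)

(** [del i a] is [a] with its letter at position [i] removed. *)
Definition del (X : Type) (r : nat) (i : 'I_r.+1) (a : r.+1.-tuple X) :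
    r.-tuple X :=
  [tuple tnth a (lift i l) | l < r].

(** [ins i x b] is the sequence with letter [x] at position [i] whose other
    letters spell [b]. *)
Definition ins (X : Type) (r : nat) (i : 'I_r.+1) (x : X) (b : r.-tuple X) :
    r.+1.-tuple X :=
  [tuple oapp (tnth b) x (unlift i l) | l < r.+1].

Lemma tnth_ins (X : Type) (r : nat) (i : 'I_r.+1) (x : X) (b : r.-tuple X) :
  tnth (ins i x b) i = x.
Proof. by rewrite tnth_mktuple unlift_none. Qed.

Lemma del_ins (X : Type) (r : nat) (i : 'I_r.+1) (x : X) (b : r.-tuple X) :
  del i (ins i x b) = b.
Proof. by apply: eq_from_tnth => l; rewrite !tnth_mktuple liftK. Qed.

Lemma ins_del (X : Type) (r : nat) (i : 'I_r.+1) (a : r.+1.-tuple X) :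
  ins i (tnth a i) (del i a) = a.
Proof.
apply: eq_from_tnth => l; rewrite tnth_mktuple.
by case: unliftP => [k ->|->] //=; rewrite tnth_mktuple.
Qed.

Lemma sum_ins (X : finType) (V : nmodType) (r : nat) (i : 'I_r.+1)
    (F : r.+1.-tuple X -> V) :
  \sum_a F a = \sum_b \sum_x F (ins i x b).
Proof.
rewrite pair_bigA /= (reindex (fun p : r.-tuple X * X => ins i p.2 p.1)) //=.
exists (fun a => (del i a, tnth a i)) => [[b x] _|a _] /=.
  by rewrite del_ins tnth_ins.
exact: ins_del.
Qed.

Lemma sum_del (X : finType) (V : nmodType) (r : nat) (i : 'I_r.+1)
    (F : r.-tuple X -> V) :
  \sum_a F (del i a) = (\sum_b F b) *+ #|X|.
Proof.
rewrite (sum_ins i) -sumrMnl; apply: eq_bigr => b _.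
by under eq_bigr do rewrite del_ins; rewrite sumr_const.
Qed.

Lemma back_subproof (s : nat) (i : 'I_s.+1) (j : 'I_s.+2) :
  (unbump i j < s.+1)%N.
Proof. rewrite /unbump; have := ltn_ord i; have := ltn_ord j; lia. Qed.

(** If [j] and [lift j i] are two distinct positions of a sequence, [back i j] is
    the position to which [j] moves once [lift j i] has been deleted. *)
Definition back (s : nat) (i : 'I_s.+1) (j : 'I_s.+2) : 'I_s.+1 :=
  Ordinal (back_subproof i j).

Lemma lift_lift (s : nat) (i : 'I_s.+1) (j : 'I_s.+2) (l : 'I_s) :
  lift j (lift i l) = lift (lift j i) (lift (back i j) l).
Proof. by apply: val_inj; rewrite /= bumpC. Qed.

Lemma lift_back (s : nat) (i : 'I_s.+1) (j : 'I_s.+2) :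
  lift (lift j i) (back i j) = j.
Proof. by apply: val_inj; rewrite /= /bump /unbump; lia. Qed.

Lemma del_del (X : Type) (s : nat) (i : 'I_s.+1) (j : 'I_s.+2)
    (a : s.+2.-tuple X) :
  del i (del j a) = del (back i j) (del (lift j i) a).
Proof. by apply: eq_from_tnth => l; rewrite !tnth_mktuple lift_lift. Qed.

Lemma del_ins_ins (X : Type) (s : nat) (i : 'I_s.+1) (j : 'I_s.+2) (x y : X)
    (b : s.-tuple X) :
  del (lift j i) (ins j y (ins i x b)) = ins (back i j) y b.
Proof.
rewrite -[LHS](ins_del (back i j)); congr ins.
  by rewrite tnth_mktuple lift_back tnth_ins.
by rewrite -del_del !del_ins.
Qed.

(** For fixed [i], the map [back i] takes the value [i] twice (at the positions
    [i] and [i + 1]) and every other value once. *)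
Lemma sum_back (V : nmodType) (s : nat) (i : 'I_s.+1) (F : 'I_s.+1 -> V) :
  \sum_j F (back i j) = \sum_l F l + F i.
Proof.
rewrite (bigD1_ord (lift ord0 i)) //= addrC; congr (_ + F _).
  by apply: eq_bigr => l _; congr F; apply: val_inj; rewrite /= /bump /unbump; lia.
by apply: val_inj; rewrite /= /bump /unbump; lia.
Qed.

(** * Counting the codewords below a sequence *)

(** [hits C a] is the number of positions of [a] whose deletion gives a codeword
    of [C]. Positions are counted, so a codeword may count several times. *)
Definition hits (X : finType) (r : nat) (C : {set r.-tuple X})
    (a : r.+1.-tuple X) : nat :=
  #|[set i | del i a \in C]|.

Lemma hitsE (K : pzSemiRingType) (X : finType) (r : nat) (C : {set r.-tuple X}) a :
  (hits C a)%:R = \sum_i (del i a \in C)%:R :> K.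
Proof.
rewrite /hits -sum1_card big_mkcond natr_sum.
by apply: eq_bigr => i _; rewrite inE; case: ifP.
Qed.

Lemma hits_le (X : finType) (r : nat) (C : {set r.-tuple X}) a :
  (hits C a <= r.+1)%N.
Proof. by rewrite -[leqRHS]card_ord max_card. Qed.

Lemma sum_mem (K : pzSemiRingType) (T : finType) (A : {set T}) :
  \sum_x (x \in A)%:R = #|A|%:R :> K.
Proof.
rewrite -sum1_card natr_sum [RHS]big_mkcond.
by apply: eq_bigr => x _; case: (x \in A).
Qed.

Lemma sum_hits (K : pzSemiRingType) (X : finType) (r : nat) (C : {set r.-tuple X}) :
  \sum_a (hits C a)%:R = r.+1%:R * #|C|%:R * #|X|%:R :> K.
Proof.
under eq_bigr do rewrite hitsE.
rewrite exchange_big /=.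
under eq_bigr do rewrite (sum_del _ (fun b => (b \in C)%:R)) sum_mem.
by rewrite sumr_const card_ord -[_ *+ #|X|]mulr_natr -[LHS]mulr_natl mulrA.
Qed.

(** The codegree of [b] at position [i]: the number of letters whose insertion
    at position [i] of [b] gives a codeword. *)
Definition codeg (X : finType) (s : nat) (C : {set s.+1.-tuple X})
    (b : s.-tuple X) (i : 'I_s.+1) : nat :=
  #|[set x | ins i x b \in C]|.

Lemma codegE (K : pzSemiRingType) (X : finType) s (C : {set s.+1.-tuple X}) b i :
  (codeg C b i)%:R = \sum_x (ins i x b \in C)%:R :> K.
Proof. by rewrite -sum_mem; apply: eq_bigr => x _; rewrite inE. Qed.

Lemma sum_codeg (K : pzSemiRingType) (X : finType) s (C : {set s.+1.-tuple X}) i :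
  \sum_b (codeg C b i)%:R = #|C|%:R :> K.
Proof.
under eq_bigr do rewrite codegE.
by rewrite -(sum_ins i (fun a => (a \in C)%:R)) sum_mem.
Qed.

(** Two distinct positions of a sequence of length [s + 2] are [j] and
    [lift j i]. Writing the sequence as [ins j y (ins i x b)] decouples the two
    membership conditions: the first one involves only [x], the second one
    only [y]. *)
Lemma sum_hits_sqr (K : comPzRingType) (X : finType) s (C : {set s.+1.-tuple X}) :
  \sum_a (hits C a)%:R ^+ 2 =
  \sum_a (hits C a)%:R +
  \sum_b ((\sum_i (codeg C b i)%:R) ^+ 2 + \sum_i (codeg C b i)%:R ^+ 2) :> K.
Proof.
have -> : \sum_a (hits C a)%:R ^+ 2 = \sum_a ((hits C a)%:R +
    \sum_j \sum_(i < s.+1) (del j a \in C)%:R * (del (lift j i) a \in C)%:R) :> K.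
  apply: eq_bigr => a _; rewrite expr2 !hitsE mulr_suml -big_split /=.
  apply: eq_bigr => j _; rewrite (bigD1_ord j) //= mulrDr mulr_sumr.
  by congr (_ + _); case: (_ \in C); rewrite ?mulr1 ?mulr0.
rewrite big_split /=; congr (_ + _).
(* The pairs of distinct positions, indexed by j and lift j i. *)
have E (j : 'I_s.+2) (i : 'I_s.+1) :
    \sum_a (del j a \in C)%:R * (del (lift j i) a \in C)%:R =
    \sum_b (codeg C b i)%:R * (codeg C b (back i j))%:R :> K.
  rewrite (sum_ins j) (sum_ins i); apply: eq_bigr => b _.
  rewrite !codegE mulr_suml; apply: eq_bigr => x _; rewrite mulr_sumr.
  by apply: eq_bigr => y _; rewrite del_ins del_ins_ins.
rewrite exchange_big /=.
under eq_bigr do rewrite exchange_big /=.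
under eq_bigr => j _ do under eq_bigr => i _ do rewrite E.
rewrite exchange_big /=.
under eq_bigr => i _ do rewrite exchange_big /=.
rewrite exchange_big /=; apply: eq_bigr => b _.
rewrite expr2 mulr_suml -big_split /=; apply: eq_bigr => i _.
rewrite -mulr_sumr -mulrDr; congr (_ * _).
exact: (sum_back i (fun k => (codeg C b k)%:R)).
Qed.

Lemma sqr_sum_le (K : realFieldType) (I : finType) (F : I -> K) :
  (\sum_i F i) ^+ 2 <= #|I|%:R * \sum_i F i ^+ 2.
Proof.
have [I0|I0] := posnP #|I|.
  by rewrite I0 mul0r big1 ?expr0n// => i _; have := fintype0 i I0.
have Ip : 0 < #|I|%:R :> K by rewrite ltr0n.
set S := \sum_i F i; set m := S / #|I|%:R.
have : 0 <= \sum_i (F i - m) ^+ 2 by apply: sumr_ge0 => i _; exact: sqr_ge0.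
have -> : \sum_i (F i - m) ^+ 2 = \sum_i F i ^+ 2 - S ^+ 2 / #|I|%:R.
  have E i : (F i - m) ^+ 2 = F i ^+ 2 - F i * (2 * m) + m ^+ 2 by ring.
  under eq_bigr do rewrite E.
  rewrite big_split sumrB /= sumr_const -mulr_suml -mulr_natl -/S /m.
  by field; rewrite gt_eqF.
by rewrite subr_ge0 ler_pdivrMr // mulrC.
Qed.

(** The quantitative form of de Caen's inequality. If every sequence has at least
    one hit, the summands on the left are nonnegative, and they vanish only when
    the number of hits is [1] or the maximal value [s + 2]. *)
Lemma hits_deficit (K : realFieldType) (X : finType) s
    (C : {set s.+1.-tuple X}) (d := #|C|%:R / #|X|%:R ^+ s.+1 : K) :
  (0 < #|X|)%N ->
  \sum_a ((hits C a)%:R - 1) * (s.+2%:R - (hits C a)%:R) <=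
    #|X|%:R ^+ s.+2 * (s.+2%:R * ((1 - d) * (s.+1%:R * d - 1))) :> K.
Proof.
move=> X0; set n : K := #|X|%:R; have n0 : 0 < n by rewrite ltr0n.
set M : K := #|C|%:R; have nN0 : n ^+ s != 0 by rewrite expf_neq0 ?gt_eqF.
have E (a : s.+2.-tuple X) :
    ((hits C a)%:R - 1) * (s.+2%:R - (hits C a)%:R) =
    (hits C a)%:R * (s.+2%:R + 1) - (hits C a)%:R ^+ 2 - s.+2%:R :> K by ring.
under eq_bigr do rewrite E.
rewrite !sumrB -mulr_suml sum_hits_sqr sum_hits big_split /= sumr_const.
rewrite card_tuple -/n -/M -[s.+2%:R *+ _]mulr_natl natrX -/n.
(* Cauchy-Schwarz for the total codegrees, then for the codegrees at each
   position. *)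
have P : M ^+ 2 * s.+1%:R ^+ 2 / n ^+ s <=
    \sum_b (\sum_i (codeg C b i)%:R) ^+ 2.
  rewrite ler_pdivrMr ?exprn_gt0// [leRHS]mulrC.
  have := @sqr_sum_le K _ (fun b : s.-tuple X => \sum_i (codeg C b i)%:R).
  rewrite card_tuple natrX exchange_big /=.
  under eq_bigr do rewrite sum_codeg.
  by rewrite sumr_const card_ord -[_ *+ s.+1]mulr_natr exprMn.
have Q : M ^+ 2 * s.+1%:R / n ^+ s <=
    \sum_b \sum_i (codeg C b i)%:R ^+ 2.
  rewrite exchange_big /= [M ^+ 2 * _]mulrC -mulrA mulr_natl.
  rewrite -[in leLHS](card_ord s.+1) -sumr_const; apply: ler_sum => i _.
  rewrite ler_pdivrMr ?exprn_gt0//.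
  have := @sqr_sum_le K _ (fun b : s.-tuple X => (codeg C b i)%:R).
  by rewrite card_tuple natrX sum_codeg mulrC.
move: P Q; set p := \sum_b _; set q := \sum_b _ => P Q.
have -> : n ^+ s.+2 * (s.+2%:R * ((1 - d) * (s.+1%:R * d - 1))) =
   s.+2%:R * M * n * (s.+2%:R + 1) - (s.+2%:R * M * n +
   (M ^+ 2 * s.+1%:R ^+ 2 / n ^+ s + M ^+ 2 * s.+1%:R / n ^+ s)) -
   n ^+ s.+2 * s.+2%:R.
  rewrite /d -/n -/M -[s.+2]addn1 -[s.+1]addn1 !natrD !exprD.
  by field; rewrite nN0 gt_eqF.
by rewrite lerD2r lerB// lerD2l lerD.
Qed.

(** * The parity obstruction *)

(** A graph in which every vertex has degree [1] has evenly many vertices. *)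
Lemma not_odd_1regular (m : nat) (e : rel 'I_m) :
  symmetric e -> irreflexive e ->
  (forall i, #|[set j | e i j]| = 1%N) -> ~~ odd m.
Proof.
move=> sym irr deg1.
have -> : m = (\sum_i \sum_(j | e i j) 1)%N.
  under eq_bigr => i _.
    have -> : (\sum_(j | e i j) 1 = 1)%N.
      by rewrite -[RHS](deg1 i) -sum1_card; apply: eq_bigl => j; rewrite inE.
    over.
  by rewrite sum1_card card_ord.
have -> : (\sum_i \sum_(j | e i j) 1 = (\sum_i \sum_(j | e i j && (i < j)) 1).*2)%N.
  rewrite -addnn [X in (_ + X)%N](exchange_big_dep xpredT) //=.
  rewrite -big_split /=; apply: eq_bigr => i _.
  rewrite (bigID (fun j : 'I_m => (i < j)%N)) /=; congr addn.
  apply: eq_bigl => j; rewrite sym.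
  by case: ltngtP => [||/val_inj ->]; rewrite ?irr ?andbT ?andbF.
by rewrite odd_double.
Qed.

(** Join two positions of [z] when deleting both gives a codeword. The degree of
    a position [v] is then [hits C (del v z)], hence lies between [1] and
    [s + 3]. The number of positions is odd, so some degree differs from [1]. *)
Lemma hits_local (K : realFieldType) (X : finType) (s : nat)
    (C : {set s.+2.-tuple X}) (z : s.+4.-tuple X) :
  odd s.+4 -> (forall a, 0 < hits C a)%N ->
  2 * s.+3%:R <=
  \sum_v ((hits C (del v z))%:R +
     2 * (((hits C (del v z))%:R - 1) * (s.+3%:R - (hits C (del v z))%:R))) :> K.
Proof.
move=> oddz pos; pose g v := hits C (del v z).
have g1 v : (1 <= g v)%N by exact: pos.
have gs v : (g v <= s.+3)%N by exact: hits_le.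
pose pen v := ((g v - 1) * (s.+3 - g v))%N.
rewrite (eq_bigr (fun v => (g v + 2 * pen v)%:R : K)); last first.
  by move=> v _; rewrite natrD !natrM !natrB ?g1 ?gs.
rewrite -natr_sum -natrM ler_nat.
have sumv (v : 'I_s.+4) :
    (g v + 2 * pen v + s.+3 <= \sum_w (g w + 2 * pen w))%N.
  rewrite (bigD1_ord v) //= leq_add2l -[leqLHS]card_ord -sum1_card.
  by apply: leq_sum => w _; exact: leq_trans (g1 _) (leq_addr _ _).
have [/existsP[v gv]|/existsPn g_1] := boolP [exists v, g v != 1%N].
  (* If g v is maximal then it alone compensates for the other degrees;
     otherwise the penalty at v is at least s + 1. *)
  apply: leq_trans (sumv v); rewrite /pen.
  have := gs v; have := g1 v; move/eqP: gv; nia.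
pose e : rel 'I_s.+4 := fun v w =>
  if unlift v w is Some l then del l (del v z) \in C else false.
have irr : irreflexive e by move=> v; rewrite /e unlift_none.
have sub v w : e v w -> e w v.
  rewrite /e; case: unliftP => // l ->; rewrite del_del => H.
  by rewrite -[X in unlift _ X](lift_back l v) liftK.
have sym : symmetric e by move=> v w; apply/idP/idP; exact: sub.
have /negP[] : ~~ odd s.+4; last by [].
apply: (not_odd_1regular sym irr) => v.
have /negbNE/eqP <- := g_1 v.
rewrite /g /hits -(card_imset _ (@lift_inj _ v)); apply: eq_card => w.
rewrite inE /e; case: unliftP => [l ->|->].
  by rewrite (mem_imset _ _ (@lift_inj _ v)) inE.
by apply/esym/imsetP => -[l _ /eqP]; rewrite (negbTE (neq_lift _ _)).
Qed.

(** * The inequality for the density of a code *)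

(** A subsequence that is one letter shorter misses exactly one position. *)
Lemma subseq_bump (T : eqType) (x0 : T) (x a : seq T) :
  subseq x a -> size a = (size x).+1 ->
  exists2 i, (i < size a)%N &
    forall j, (j < size x)%N -> nth x0 x j = nth x0 a (bump i j).
Proof.
elim: a x => [|y a IH] [|z x] //= sub [sz]; first by exists 0%N.
case: eqP sub => [->|_] sub.
  have [i ia xa] := IH x sub sz.
  by exists i.+1 => // -[|j] // jx; rewrite bumpS /=; exact: xa.
exists 0%N => // j jx; rewrite /bump leq0n add1n /=.
by have := size_subseq_leqif sub; rewrite /= sz => -[_]; rewrite eqxx => /esym/eqP ->.
Qed.

Lemma covering_codeP (X : finType) (r : nat) (C : {set r.-tuple X}) :
  covering_code r.+1 C -> forall a, (0 < hits C a)%N.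
Proof.
move=> /forallP cov a; have /exists_inP[x xC sub] := cov a.
have x0 : X by have := tnth a ord0.
have [|i ia xa] := subseq_bump x0 sub; first by rewrite !size_tuple.
rewrite size_tuple in ia.
rewrite /hits card_gt0; apply/set0Pn; exists (Ordinal ia); rewrite inE.
suff -> : del (Ordinal ia) a = x by [].
apply: eq_from_tnth => l; rewrite tnth_mktuple !(tnth_nth x0) xa //.
by rewrite size_tuple.
Qed.

(** The average of [hits_local] over all sequences of length [s + 4], combined
    with [hits_deficit]. *)
Lemma covering_density (K : realFieldType) (X : finType) s
    (C : {set s.+2.-tuple X}) (d := #|C|%:R / #|X|%:R ^+ s.+2 : K) :
  odd s -> (0 < #|X|)%N -> covering_code s.+3 C ->
  2 <= s.+4%:R * (d + 2 * ((1 - d) * (s.+2%:R * d - 1))).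
Proof.
move=> os X0 /covering_codeP pos; set n : K := #|X|%:R.
have n0 : 0 < n by rewrite ltr0n.
have odz : odd s.+4 by rewrite /= !negbK.
have := @ler_sum K _ (index_enum _) xpredT _ _
  (fun z _ => hits_local K z odz pos).
(* Each sequence a arises as del v z, for fixed v, from #|X| sequences z. *)
rewrite exchange_big /= sumr_const card_tuple.
under eq_bigr => v _ do
  rewrite (sum_del v (fun a => (hits C a)%:R +
     2 * (((hits C a)%:R - 1) * (s.+3%:R - (hits C a)%:R)))).
rewrite sumr_const card_ord big_split /= sum_hits -mulr_sumr.
have := @hits_deficit K X s.+1 C X0; rewrite -/n -/d.
set p := \sum_a _ => pd.
rewrite -[_ *+ s.+4]mulr_natl -[_ *+ #|X|]mulr_natl.
rewrite -[_ *+ (_ ^ _)%N]mulr_natl natrX -/n => le.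
have Md : #|C|%:R = d * n ^+ s.+2 by rewrite /d divfK // expf_neq0 ?gt_eqF.
have {le} : n ^+ s.+4 * (2 * s.+3%:R) <= s.+4%:R * (n * (s.+3%:R * (d * n ^+ s.+2) * n +
   2 * (n ^+ s.+3 * (s.+3%:R * ((1 - d) * (s.+2%:R * d - 1)))))).
  apply: le_trans le _; rewrite ler_pM2l ?ltr0n// ler_pM2l// Md lerD2l.
  by rewrite ler_pM2l.
rewrite (_ : s.+4%:R * _ = (n ^+ s.+4 * s.+3%:R) *
    (s.+4%:R * (d + 2 * ((1 - d) * (s.+2%:R * d - 1))))).
  rewrite [2 * s.+3%:R]mulrC [_ * (s.+3%:R * 2)]mulrA.
  by rewrite ler_pM2l// mulr_gt0 ?exprn_gt0 ?ltr0n.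
by rewrite [n ^+ s.+4]exprS [n ^+ s.+3]exprS; ring.
Qed.

(** With [d = 1 / r + t], the hypothesis gives
    [2 / (r + 2) <= 1 / r + (2 * r - 1) * t], whence
    [t >= (r - 2) / (r * (r + 2) * (2 * r - 1))]; the latter is more than
    [1 / (4 * r ^+ 3)]. *)
Lemma density_bound (K : realFieldType) (r d : K) :
  3 <= r -> 2 <= (r + 2) * (d + 2 * ((1 - d) * (r * d - 1))) ->
  1 / r + 1 / (4 * r ^+ 3) <= d.
Proof.
move=> r3 H; rewrite leNgt; apply/negP => dlt.
have r0 : 0 < r by lra.
set e := 1 / (4 * r ^+ 3) in dlt; pose t := d - 1 / r.
have te : t < e by rewrite /t ltrBlDl.
have dE : d + 2 * ((1 - d) * (r * d - 1)) =
    1 / r + (2 * r - 1) * t - 2 * r * t ^+ 2.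
  by rewrite /t; field; rewrite gt_eqF.
have le1 : d + 2 * ((1 - d) * (r * d - 1)) <= 1 / r + (2 * r - 1) * e.
  rewrite dE; have : 0 <= 2 * r * t ^+ 2 by rewrite mulr_ge0 ?sqr_ge0 //; lra.
  have : (2 * r - 1) * t <= (2 * r - 1) * e by rewrite ler_pM2l; lra.
  lra.
have : 2 <= (r + 2) * (1 / r + (2 * r - 1) * e).
  by apply: (le_trans H); rewrite ler_pM2l; lra.
apply/negP; rewrite -ltNge.
have -> : (r + 2) * (1 / r + (2 * r - 1) * e) =
    2 - (4 * r ^+ 3 - 10 * r ^+ 2 - 3 * r + 2) / (4 * r ^+ 3).
  by rewrite /e; field; rewrite gt_eqF.
rewrite ltrBlDr ltrDl divr_gt0//; last by rewrite mulr_gt0 ?exprn_gt0.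
nra.
Qed.

(** * Existence of the limit *)

(** The sequences whose reduction modulo [m] lies in a covering code over [m]
    letters form a covering code over [N] letters. Each such sequence is
    determined by its remainders, a codeword, and its quotients, each at most
    [N %/ m]. *)
Lemma min_cover_blowup (N m k r : nat) : (0 < m)%N -> (r <= k)%N ->
  (min_cover N k r <= min_cover m k r * (N %/ m).+1 ^ r)%N.
Proof.
move=> m0 rk.
have [[C cov <-] _] := min_coverP m rk; have [_ minN] := min_coverP N rk.
pose f (x : 'I_N) : 'I_m := Ordinal (ltn_pmod x m0).
have qP (x : 'I_N) : (x %/ m < (N %/ m).+1)%N by rewrite ltnS leq_div2r// ltnW.
pose q (x : 'I_N) : 'I_(N %/ m).+1 := Ordinal (qP x).
pose D : {set r.-tuple 'I_N} := [set t | map_tuple f t \in C].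
have Dcov : covering_code k D.
  apply/forallP => a.
  have /forallP/(_ (map_tuple f a))/exists_inP[x xC] := cov.
  case/subseqP => b; rewrite size_map => sb xE.
  have sz : size (mask b a) == r by rewrite -(size_map f) map_mask -xE size_tuple.
  apply/exists_inP; exists (Tuple sz); last exact: mask_subseq.
  rewrite inE (_ : map_tuple f _ = x)//; apply: val_inj.
  by rewrite /= map_mask.
apply: leq_trans (minN D Dcov) _.
have -> : ((N %/ m).+1 ^ r)%N = #|[set: r.-tuple 'I_(N %/ m).+1]|.
  by rewrite cardsT card_tuple card_ord.
rewrite -cardsX.
pose h (t : r.-tuple 'I_N) := (map_tuple f t, map_tuple q t).
have hI : injective h.
  move=> t u [ft qt].
  apply: eq_from_tnth => i.
  have tf := congr1 (fun s => nth (f (tnth t i)) s i) ft.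
  have tq := congr1 (fun s => nth (q (tnth t i)) s i) qt.
  rewrite /= !(nth_map (tnth t i)) ?size_tuple// -!tnth_nth in tf tq.
  apply: val_inj; rewrite /= (divn_eq (tnth t i) m) (divn_eq (tnth u i) m).
  by rewrite -[(_ %% m)%N]/(val (f _)) -[(tnth t i %/ m)%N]/(val (q _)) tf tq.
rewrite -(card_imset _ hI); apply: subset_leq_card.
by apply/fintype.subsetP => _ /imsetP[t tD ->]; rewrite inE /= !inE andbT; move: tD; rewrite inE.
Qed.

Lemma density_blowup (K : realFieldType) (N m k r : nat) :
  (0 < N)%N -> (0 < m)%N -> (r <= k)%N ->
  (min_cover N k r)%:R / N%:R ^+ r <=
  (1 + m%:R / N%:R) ^+ r * ((min_cover m k r)%:R / m%:R ^+ r) :> K.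
Proof.
move=> N0 m0 rk.
have NK : 0 < N%:R :> K by rewrite ltr0n.
have mK : 0 < m%:R :> K by rewrite ltr0n.
rewrite ler_pdivrMr ?exprn_gt0//.
rewrite (_ : _ * _ * _ = (min_cover m k r)%:R * ((N + m)%:R / m%:R) ^+ r); last first.
  rewrite [in RHS]natrD (_ : (N%:R + m%:R) / m%:R = (1 + m%:R / N%:R) * m%:R^-1 * N%:R).
    by rewrite !exprMn exprVn; ring.
  by field; rewrite !gt_eqF.
apply: le_trans (_ : (min_cover m k r * (N %/ m).+1 ^ r)%:R <= _).
  by rewrite ler_nat min_cover_blowup.
rewrite natrM natrX ler_wpM2l// lerXn2r ?nnegrE ?divr_ge0//.
rewrite ler_pdivlMr// -natrM ler_nat mulSn addnC leq_add2r.
exact: leq_trunc_div.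
Qed.

Local Open Scope classical_set_scope.

(** By [density_blowup], the limit superior of the densities is at most the
    density over any nonempty alphabet; so the densities converge to their infimum
    over nonempty alphabets. *)
Lemma is_cvg_cover_density (R : realType) (k r : nat) : (r <= k)%N ->
  cvgn (fun n : nat => (min_cover n k r)%:R / n%:R ^+ r : R).
Proof.
move=> rk; pose d n : R := (min_cover n k r)%:R / n%:R ^+ r.
have d0 n : 0 <= d n by rewrite divr_ge0// exprn_ge0.
pose E := range (fun m => d m.+1).
have Elb : has_lbound E by exists 0 => _ [m _ <-].
have Einf : has_inf E by split=> //; exists (d 1), 0%N.
apply/cvg_ex; exists (inf E); rewrite -cvg_shiftS.
apply/cvgrPdist_lt => e e0.
have [_ [m _ <-] dm] := inf_adherent e0 Einf.
have c : (1 + m.+1%:R * harmonic n) ^+ r * d m.+1 @[n --> \oo] --> d m.+1.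
  have c1 : 1 + m.+1%:R * harmonic n @[n --> \oo] --> (1 + m.+1%:R * 0 : R).
    by apply: cvgD; [exact: cvg_cst | apply: cvgMl_tmp cvg_harmonic].
  suff : (1 + m.+1%:R * harmonic n) ^+ r * d m.+1 @[n --> \oo] -->
      (1 + m.+1%:R * 0 : R) ^+ r * d m.+1 by rewrite mulr0 addr0 expr1n mul1r.
  apply: cvgMr_tmp.
  exact: (continuous_cvg _ (@exprn_continuous R r _) c1).
near=> n.
have le1 : inf E <= d n.+1 by apply: ge_inf => //; exists n.
rewrite distrC ger0_norm ?subr_ge0// ltrBlDl.
apply: le_lt_trans (density_blowup _ (ltn0Sn n) (ltn0Sn m) rk) _.
near: n; exact: (cvgr_lt _ c).
Unshelve. all: by end_near. Qed.

(** * The lower bound *)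

Lemma cover_density_ge (R : realType) (r : nat) : odd r -> (3 <= r)%N ->
  1 / r%:R + 1 / (4 * r%:R ^+ 3) <= cover_density R r.+1 r.
Proof.
case: r => [|[|s]] //= os r3; rewrite negbK in os.
apply: limr_ge; first exact: is_cvg_cover_density.
near=> n.
have n0 : (0 < n)%N by near: n; exact: nbhs_infty_gt.
have [[C cov <-] _] := min_coverP n (leqnSn s.+2).
apply: density_bound; first by rewrite ler_nat.
have := @covering_density R 'I_n s C os; rewrite card_ord => /(_ n0 cov).
by rewrite -natrD addn2.
Unshelve. all: by end_near. Qed.

Theorem corollary16 (R : realType) :
  exists eps : nat -> R,
    (eps r @[r --> within [set r : nat | odd r] \oo] --> (0 : R)) /\
    (forall r : nat, odd r -> (3 <= r)%N ->
       1 / r%:R + (1 - eps r) / (4 * r%:R ^+ 6 * (r`!)%:R ^+ 2)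
         <= cover_density R r.+1 r).
Proof.
exists (fun=> 0); split=> [|r oddr r3]; first exact: cvg_cst.
apply: le_trans (cover_density_ge R oddr r3).
have r0 : (0 < r)%N by apply: leq_trans r3.
have r1 : 1 <= r%:R :> R by rewrite ler1n.
have f1 : 1 <= (r`!)%:R :> R by rewrite ler1n fact_gt0.
rewrite subr0 lerD2l !mul1r lef_pV2 ?posrE ?mulr_gt0 ?exprn_gt0 ?ltr0n ?fact_gt0//.
rewrite -mulrA ler_pM2l// -[leLHS]mulr1.
by apply: ler_pM; rewrite ?exprn_ge0 ?exprn_ege1 ?ler_weXn2l.
Qed.
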